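(* Let $G$ be a group acting by isometries on a $\delta$-hyperbolic geodesic metric space $X$ ($\delta>0$), and let $\mathcal{C}=(C,\{G_c\mid c\in C\})$ be a $\rho$-separated fairly rotating family with $\rho\ge 20\delta$. Fix $R$ with $2+2\delta\le R\le \frac{\rho}{2}-3\delta$, and let $\mathcal{Y}=\{S_p\}_{p\in C}$ with projections $\pi_p$ as defined in the context. Then for $\theta\ge 121\delta$, the group $G$ acts by isometries on a projection complex associated to the family $(\mathcal{Y},\{\pi_p\}_{p\in C})$ (upgraded so as to satisfy the strong projection axioms with constant $\theta$). Moreover, the family of subgroups $\{G_c\}_{c\in C}$ is an $L$-spinning family for this action, with $$L=2^{\frac{R-2}{\delta}}-4-248\delta.$$
   Context: A geodesic metric space $X$ is $\delta$-hyperbolic if every geodesic triangle is $\delta$-thin: for the map $\chi_\Delta$ from a triangle $\Delta$ to its comparison tripod (isometric on each side), any two points with the same image are at distance $\le\delta$. $B_R(p)$ denotes the open ball of radius $R$ about $p$. A rotating family $\mathcal{C}=(C,\{G_c\mid c\in C\})$ for an isometric action of $G$ on $X$ consists of a subset $C\subseteq X$ (apices) and subgroups $G_c\le G$ such that: $C$ is $G$-invariant; each $G_c$ fixes $c$; and $G_{gc}=gG_cg^{-1}$ for all $g\in G$, $c\in C$. It is $\rho$-separated if distinct apices are at distance at least $\rho$. It is fairly rotating if for all $c\in C$, all $g\in G_c\setminus\{1\}$ and all $x\in C$ with $x\ne c$, there is a geodesic from $x$ to $gx$ meeting the closed ball of radius $1$ about $c$. For $p\in C$, $S_p=\{x\in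 X: d(x,p)=R\}$, equipped with the metric $d_{S_p}(x,y)=$ infimum of lengths of paths from $x$ to $y$ in $X\setminus B_R(p)$ ($=\infty$ if there is no such path). For $a\in C\setminus\{p\}$ (or more generally any point $a$ with $d(a,p)\ge R$), $\pi_p(a)\subseteq S_p$ is the set of nearest-point projections of $a$ to $S_p$, equivalently the set of intersection points of geodesics $[p,a]$ with $S_p$. Write $d_p(a,b)=\operatorname{diam}_{S_p}(\pi_p(a)\cup\pi_p(b))$. Projection axioms with constant $\theta$ for a collection $\mathcal{Y}$ of metric spaces with maps $\pi_Y:\mathcal{Y}\setminus\{Y\}\to 2^Y$, writing $d_Y(X,Z)=\operatorname{diam}(\pi_Y(X)\cup\pi_Y(Z))$: (P1) $\operatorname{diam}\pi_Y(X)\le\theta$ for $X\ne Y$; (P2) if $d_Y(X,Z)>\theta$ then $d_X(Y,Z)\le\theta$; (P3) for any $X,Z$ the set $\{Y\ne X,Z: d_Y(X,Z)>\theta\}$ is finite. Strong projection axioms: (P1), (P3), and (P2+) if $d_X(Y,Z)>\theta$ then $d_Y(Z,W)=d_Y(X,W)$ for all distinct $X,Y,Z,W$. By a theorem of Bestvina–Bromberg–Fujiwara–Sisto (used here as a black box), data satisfying the projection axioms with constant $\theta_0$ can be replaced by projections $\pi'_Y$ satisfying the strong projection axioms with constant $11\theta_0$ and with $d_Y-2\theta_0\le d'_Y\le d_Y+2\theta_0$; this is the ''upgrade''. The projection complex $\mathcal{P}(\mathcal{Y},\theta,K)$ (with $K\ge 3\theta$) is the graph with vertex set $\mathcal{Y}$,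 in which $X\ne Z$ are adjacent iff $d_Y(X,Z)\le K$ for every $Y\in\mathcal{Y}\setminus\{X,Z\}$; vertices $S_p$ are identified with $p\in C$. For a group $G$ acting on a projection complex $\mathcal{P}$, a family $\{G_c\}_{c\in V\mathcal{P}}$ with $G_c$ contained in the stabilizer of $c$ is an $L$-spinning family if $gG_cg^{-1}=G_{gc}$ for all $g\in G$, and $d_a(b,gb)\ge L$ for all distinct vertices $a,b$ and all $g\in G_a\setminus\{1\}$. *)

(* Defs.v *)
From HB Require Import structures.
From mathcomp Require Import all_boot all_order all_algebra.
From mathcomp Require Import all_classical all_reals.
From mathcomp Require Import ereal topology normedtype sequences exp.

Set Implicit Arguments.
Unset Strict Implicit.
Unset Printing Implicit Defensive.

Import Order.TTheory GRing.Theory Num.Theory.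
Local Open Scope classical_set_scope.
Local Open Scope ring_scope.

Section Geometry.
Context {R : realType} {X : Type} (d : X -> X -> R).

Definition is_metric : Prop :=
  (forall x y, d x y = 0 <-> x = y) /\
  (forall x y, d x y = d y x) /\
  (forall x y z, d x z <= d x y + d y z).

Definition geodesic (x y : X) (g : R -> X) : Prop :=
  g 0 = x /\ g (d x y) = y /\
  forall s t, 0 <= s <= d x y -> 0 <= t <= d x y -> d (g s) (g t) = `|s - t|.

Definition geodesic_space : Prop := forall x y, exists g, geodesic x y g.

(** Gromov product (y|z)_w : the length of the leg at w of the comparison tripod. *)
Definition gromov (w y z : X) : R := (d w y + d w z - d y z) / 2.

(** The geodesic triangle with sides g1 = [x,y], g2 = [y,z], g3 = [z,x] is
    delta-thin: points with the same image in the comparison tripod are at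
    distance <= delta.  (Points identified by chi are exactly the points on
    the two sides issuing from a vertex v at the same distance t <= (.|.)_v
    from v.) *)
Definition thin_triangle (delta : R) (x y z : X) (g1 g2 g3 : R -> X) : Prop :=
  (forall t, 0 <= t <= gromov x y z -> d (g1 t) (g3 (d z x - t)) <= delta) /\
  (forall t, 0 <= t <= gromov y z x -> d (g2 t) (g1 (d x y - t)) <= delta) /\
  (forall t, 0 <= t <= gromov z x y -> d (g3 t) (g2 (d y z - t)) <= delta).

Definition hyperbolic (delta : R) : Prop :=
  forall x y z g1 g2 g3, geodesic x y g1 -> geodesic y z g2 -> geodesic z x g3 ->
    thin_triangle delta x y z g1 g2 g3.

Definition cont_path (g : R -> X) : Prop :=
  forall s, 0 <= s <= 1 -> forall e, 0 < e ->
    exists2 r, 0 < r & forall t, 0 <= t <= 1 -> `|s - t| < r -> d (g s) (g t) < e.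

Definition poly_sum (g : R -> X) (s : seq R) : R :=
  \sum_(i < (size s).-1) d (g (nth 0 s i)) (g (nth 0 s i.+1)).

Definition path_length (g : R -> X) : \bar R :=
  ereal_sup [set (poly_sum g s)%:E | s in
    [set s : seq R | sorted <=%R s /\ all (fun t => (0 <= t <= 1)) s]].

Definition sphere (r : R) (p : X) : set X := [set x | d x p = r].

(** Induced path metric d_{S_p}: infimum of lengths of paths in X \ B_r(p)
    (= +oo if there is none). *)
Definition dS (r : R) (p : X) (x y : X) : \bar R :=
  ereal_inf [set path_length g | g in
    [set g : R -> X | cont_path g /\ g 0 = x /\ g 1 = y /\
                      forall t, 0 <= t <= 1 -> r <= d p (g t)]].

Definition diamS (r : R) (p : X) (A : set X) : \bar R :=
  ereal_sup [set dS r p x y | x in A & y in A].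

(** pi_p(a): intersection points of geodesics [p,a] with S_p. *)
Definition sproj (r : R) (p a : X) : set X :=
  [set x | exists g, geodesic p a g /\ g r = x].

Definition dproj (r : R) (pi : X -> X -> set X) (p a b : X) : \bar R :=
  diamS r p (pi p a `|` pi p b).

(** Projection axioms (P1),(P2),(P3) with constant theta, for the family
    indexed by C (vertex S_p identified with p). *)
Definition projection_axioms (r : R) (C : set X) (pi : X -> X -> set X) (theta : R) : Prop :=
  (forall p a, C p -> C a -> a <> p -> (diamS r p (pi p a) <= theta%:E)%E) /\
  (forall x y z, C x -> C y -> C z -> x <> y -> y <> z -> x <> z ->
     (theta%:E < dproj r pi y x z)%E -> (dproj r pi x y z <= theta%:E)%E) /\
  (forall x z, C x -> C z ->
     finite_set [set y | C y /\ y <> x /\ y <> z /\ (theta%:E < dproj r pi y x z)%E]).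

Definition strong_projection_axioms (r : R) (C : set X) (pi : X -> X -> set X) (theta : R) : Prop :=
  (forall p a, C p -> C a -> a <> p -> (diamS r p (pi p a) <= theta%:E)%E) /\
  (forall x y z w, C x -> C y -> C z -> C w ->
     x <> y -> x <> z -> x <> w -> y <> z -> y <> w -> z <> w ->
     (theta%:E < dproj r pi x y z)%E -> dproj r pi y z w = dproj r pi y x w) /\
  (forall x z, C x -> C z ->
     finite_set [set y | C y /\ y <> x /\ y <> z /\ (theta%:E < dproj r pi y x z)%E]).

Definition pc_adj (r : R) (C : set X) (pi : X -> X -> set X) (K : R) (p q : X) : Prop :=
  C p /\ C q /\ p <> q /\
  forall y, C y -> y <> p -> y <> q -> (dproj r pi y p q <= K%:E)%E.

Fixpoint pc_within (r : R) (C : set X) (pi : X -> X -> set X) (K : R) (n : nat)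
    (p q : X) : Prop :=
  match n with
  | 0 => C p /\ p = q
  | n'.+1 => (C p /\ p = q) \/
             exists y, pc_adj r C pi K p y /\ pc_within r C pi K n' y q
  end.

End Geometry.

Section Groups.
Context {G : Type} (mul : G -> G -> G) (one : G) (inv : G -> G).

Definition is_group : Prop :=
  (forall a b c, mul a (mul b c) = mul (mul a b) c) /\
  (forall a, mul one a = a) /\ (forall a, mul (inv a) a = one).

Definition subgroup (H : set G) : Prop :=
  H one /\ (forall a b, H a -> H b -> H (mul a b)) /\ (forall a, H a -> H (inv a)).

Context {R : realType} {X : Type} (d : X -> X -> R) (act : G -> X -> X).

Definition isometric_action : Prop :=
  (forall x, act one x = x) /\ (forall g h x, act (mul g h) x = act g (act h x)) /\
  (forall g x y, d (act g x) (act g y) = d x y).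

Definition rotating_family (C : set X) (Gc : X -> set G) : Prop :=
  (forall g c, C c -> C (act g c)) /\
  (forall c, C c -> subgroup (Gc c)) /\
  (forall c g, C c -> Gc c g -> act g c = c) /\
  (forall g c, C c -> Gc (act g c) = [set mul (mul g h) (inv g) | h in Gc c]).

Definition rho_separated (rho : R) (C : set X) : Prop :=
  forall c c', C c -> C c' -> c <> c' -> rho <= d c c'.

Definition fairly_rotating (C : set X) (Gc : X -> set G) : Prop :=
  forall c g x, C c -> Gc c g -> g <> one -> C x -> x <> c ->
    exists gam, geodesic d x (act g x) gam /\
      exists2 t, 0 <= t <= d x (act g x) & d (gam t) c <= 1.

End Groups.

(* Main.v *)
(* If (a|b)_p >= r + delta, geodesics [p,a] and [p,b] can be joined just outside
   the r-ball, so d_p(a,b) <= 3 delta.  Since (x|z)_y + (y|z)_x = d(x,y) and apices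
   are 2r + 6 delta apart, the projection axioms hold with constant 3 delta.

   The upgrade is built by hand instead of quoting the theorem of Bestvina,
   Bromberg, Fujiwara and Sisto.  Fix p and join two apices whenever one lies in
   the shadow of the other as seen from p, i.e. (p|v)_u < r + delta; the new
   projection of a is the union of the projections of all apices in its connected
   component.  In a finite zigzag of shadows all members lie in the slightly larger
   shadow of the member nearest to p, so components have projections of diameter
   at most 3 delta, and the new projection is constant along shadows, which is
   (P2+).

   For spinning, a path of length l outside the r-ball about c, extended by
   4 delta, joins two points of a geodesic passing within 1 of c.  Halving the
   path n times moves a point of that geodesic to within n delta + l / 2^(n+1)
   of the path, hence l is exponentially large in r. *)

Require Import Defs.
From mathcomp Require Import all_boot all_order all_algebra.
From mathcomp Require Import all_classical all_reals.
From mathcomp Require Import ereal topology normedtype exp.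
From mathcomp Require Import zify ring lra.
Import Order.TTheory GRing.Theory Num.Theory numFieldNormedType.Exports.
Local Open Scope classical_set_scope.
Local Open Scope ring_scope.

Set Implicit Arguments.
Unset Strict Implicit.
Unset Printing Implicit Defensive.

Lemma le_ereal_infD (R : realType) (A B : set \bar R) (c : \bar R) :
  lbound A 0%E -> lbound B 0%E ->
  (forall a, A a -> forall b, B b -> (c <= a + b)%E) ->
  (c <= ereal_inf A + ereal_inf B)%E.
Proof.
move=> /le_ereal_inf_tmp A0 /le_ereal_inf_tmp B0 cAB.
have [->|Aoo] := eqVneq (ereal_inf A) +oo%E.
  by rewrite addye ?leey// gt_eqF// (lt_le_trans _ B0)// ltNy0.
have [->|Boo] := eqVneq (ereal_inf B) +oo%E.
  by rewrite addey ?leey// gt_eqF// (lt_le_trans _ A0)// ltNy0.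
have Afin : ereal_inf A \is a fin_num by rewrite ge0_fin_numE// ltey.
have Bfin : ereal_inf B \is a fin_num by rewrite ge0_fin_numE// ltey.
apply/lee_addgt0Pr => e e0; have e2 : 0 < e / 2 by lra.
have [a Aa ltae] := lb_ereal_inf_adherent e2 Afin.
have [b Bb ltbe] := lb_ereal_inf_adherent e2 Bfin.
apply: le_trans (cAB a Aa b Bb) _; rewrite [e in leRHS](splitr e) EFinD addeACA.
exact: leeD (ltW ltae) (ltW ltbe).
Qed.

Lemma powR_lt_exprn_truncS (R : realType) (a x : R) :
  1 < a -> 0 <= x -> powR a x < a ^+ (Num.trunc x).+1.
Proof.
move=> a1 x0; have a0 : 0 < a := lt_trans ltr01 a1.
rewrite -powR_mulrn ?ltW// /powR gt_eqF//= ltr_expR ltr_pM2r ?ln_gt0//.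
by have /andP[] := truncn_itv x0.
Qed.

(* [l] and [r] are the two sides of [x :: s] read outwards from its minimum [m]. *)
Lemma exists_min_split (R : realType) (T : Type) (f : T -> R) x s :
  exists l m r, [/\ x :: s = rev l ++ m :: r, last m l = x, last m r = last x s &
    all (fun w => f m <= f w) (x :: s)].
Proof.
elim: s x => [|y s IH] x; first by exists [::], x, [::]; rewrite /= lexx.
have [l [m [r [def_s last_l last_r min_m]]]] := IH y.
have [xm|mx] := lerP (f x) (f m).
  exists [::], x, (y :: s); split=> //=; rewrite lexx.
  by apply: sub_all min_m => w; apply: le_trans.
by exists (rcons l x), m, r; rewrite rev_rcons last_rcons def_s /= -def_s ltW.
Qed.

(** * Lengths of paths and the path metric outside a ball *)

Section MetricSpace.
Variables (R : realType) (X : Type) (d : X -> X -> R).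
Hypothesis metric_d : is_metric d.
Implicit Types (x y z p q a b c u v w : X) (r t e D : R) (g h k : R -> X).

Lemma dist_refl x : d x x = 0.
Proof. by case: metric_d => /(_ x x) [_ ->]. Qed.

Lemma dist_sym x y : d x y = d y x.
Proof. by case: metric_d => _ []. Qed.

Lemma dist_triangle y x z : d x z <= d x y + d y z.
Proof. by case: metric_d => _ []. Qed.

Lemma dist_ge0 x y : 0 <= d x y.
Proof. by have := dist_triangle y x x; rewrite dist_refl (dist_sym y x); lra. Qed.

Fixpoint chain_length (s : seq X) : R :=
  if s is x :: s' then (if s' is y :: _ then d x y else 0) + chain_length s' else 0.

Arguments chain_length : simpl never.

Lemma chain_length1 x : chain_length [:: x] = 0.
Proof. exact: addr0. Qed.

Lemma chain_length_cons x y s :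
  chain_length [:: x, y & s] = d x y + chain_length (y :: s).
Proof. by []. Qed.

Lemma chain_length_ge0 s : 0 <= chain_length s.
Proof.
elim: s => [|x [|y s] IH] //; first by rewrite chain_length1.
by rewrite chain_length_cons addr_ge0 ?dist_ge0.
Qed.

Lemma chain_length_cat s1 z s2 :
  chain_length (s1 ++ z :: s2) = chain_length (rcons s1 z) + chain_length (z :: s2).
Proof.
elim: s1 => [|x [|y s1] IH]; first by rewrite chain_length1 add0r.
  by rewrite /= !chain_length_cons chain_length1 addr0.
by rewrite !(rcons_cons, cat_cons) !chain_length_cons -addrA -IH.
Qed.

Lemma chain_length_insert z s1 s2 :
  chain_length (s1 ++ s2) <= chain_length (s1 ++ z :: s2).
Proof.
elim: s1 => [|x [|y s1] IH]; last by rewrite !cat_cons !chain_length_cons lerD2l.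
  by case: s2 => [|y s2] /=; rewrite ?chain_length1 ?chain_length_cons ?lerDr ?dist_ge0.
case: s2 IH => [|y s2] _ /=; rewrite !chain_length_cons ?chain_length1.
  by rewrite addr0 dist_ge0.
by have := dist_triangle z x y; lra.
Qed.

Lemma chain_length_rev s : chain_length (rev s) = chain_length s.
Proof.
elim: s => [|x [|y s] IH] //; rewrite rev_cons rev_cons -cats1 cat_rcons.
rewrite chain_length_cat -rev_cons IH !chain_length_cons chain_length1.
by rewrite addr0 addrC dist_sym.
Qed.

Lemma dist_le_chain_length x s : d x (last x s) <= chain_length (x :: s).
Proof.
elim: s x => [|y s IH] x /=; first by rewrite dist_refl chain_length1.
by apply: le_trans (dist_triangle y _ _) _; rewrite chain_length_cons lerD2l.
Qed.

Lemma chain_split e t x s : 0 <= e -> 0 <= t <= chain_length (x :: s) ->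
  path (fun u v => d u v <= e) x s ->
  exists s1 s2, [/\ s = s1 ++ s2, chain_length (x :: s1) <= t + e &
    chain_length (last x s1 :: s2) <= chain_length (x :: s) - t].
Proof.
move=> e0; elim: s x t => [|y s IH] x t t_itv.
  by exists [::], [::]; split=> //=; rewrite chain_length1 in t_itv *; lra.
rewrite chain_length_cons in t_itv * => /andP[xye path_s].
have [txy|xyt] := lerP t (d x y).
  by exists [:: y], s; split=> //=; rewrite ?chain_length_cons ?chain_length1; lra.
have [|s1 [s2 [-> len1 len2]]] := IH y (t - d x y) _ path_s; first by lra.
by exists (y :: s1), s2; split=> //=; rewrite ?chain_length_cons; lra.
Qed.

Definition partition01 (s : seq R) : Prop :=
  sorted <=%R s /\ all (fun t => 0 <= t <= 1) s.

Lemma poly_sum_chain_length g s : poly_sum d g s = chain_length (map g s).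
Proof.
elim: s => [|t [|u s] IH]; first by rewrite /poly_sum big_ord0.
  by rewrite /poly_sum big_ord0 chain_length1.
by rewrite /= chain_length_cons -IH /poly_sum /= big_ord_recl.
Qed.

Lemma poly_sum_le_length g s :
  partition01 s -> ((poly_sum d g s)%:E <= path_length d g)%E.
Proof. by move=> part_s; apply: ereal_sup_ubound; exists s. Qed.

Lemma path_length_le g (M : \bar R) :
  (forall s, partition01 s -> ((poly_sum d g s)%:E <= M)%E) ->
  (path_length d g <= M)%E.
Proof. by move=> gM; apply: ge_ereal_sup => _ [s part_s <-]; apply: gM. Qed.

Lemma path_length_ge0 g : (0 <= path_length d g)%E.
Proof.
by have := @poly_sum_le_length g [::]; rewrite poly_sum_chain_length; apply.
Qed.

Definition lipschitz01 (L : R) g : Prop :=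
  forall s t, 0 <= s <= 1 -> 0 <= t <= 1 -> d (g s) (g t) <= L * `|s - t|.

Lemma lipschitz01_ge0 L g : lipschitz01 L g -> 0 <= L.
Proof.
move=> /(_ 0 1 ltac:(lra) ltac:(lra)); have := dist_ge0 (g 0) (g 1).
by rewrite sub0r normrN normr1; lra.
Qed.

Lemma lipschitz_cont_path L g : lipschitz01 L g -> cont_path d g.
Proof.
move=> lip_g s s01 e e0; have L0 := lipschitz01_ge0 lip_g.
exists (e / (L + 1)) => [|t t01]; first by rewrite divr_gt0//; lra.
rewrite ltr_pdivlMr; last by lra.
move=> st; apply: le_lt_trans (lip_g _ _ s01 t01) _.
by have := normr_ge0 (s - t); nra.
Qed.

Lemma lipschitz_chain_length L g t s : lipschitz01 L g ->
  partition01 (t :: s) -> chain_length (map g (t :: s)) <= L * (1 - t).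
Proof.
move=> lip_g; have L0 := lipschitz01_ge0 lip_g.
elim: s t => [|u s IH] t [/= sorted_s /andP[t01 s01]].
  by rewrite chain_length1; nra.
move: sorted_s s01 => /andP[tu sorted_s] /andP[u01 s01].
have : chain_length (map g (u :: s)) <= L * (1 - u).
  by apply: IH; split=> //=; rewrite u01.
rewrite /= chain_length_cons; have := lip_g _ _ t01 u01.
by rewrite ler0_norm ?subr_le0//; nra.
Qed.

Lemma lipschitz_path_length L g : lipschitz01 L g -> (path_length d g <= L%:E)%E.
Proof.
move=> lip_g; have L0 := lipschitz01_ge0 lip_g.
apply: path_length_le => -[|t s] part_s; rewrite poly_sum_chain_length lee_fin//.
apply: le_trans (lipschitz_chain_length lip_g part_s) _.
by case: part_s => _ /= /andP[t01 _]; nra.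
Qed.

Definition rev_path01 g : R -> X := fun t => g (1 - t).

Lemma cont_path_rev g : cont_path d g -> cont_path d (rev_path01 g).
Proof.
move=> cont_g s s01 e e0; have [|r r0 near_s] := cont_g (1 - s) _ e e0; first by lra.
exists r => // t t01 st; apply: near_s; first by lra.
by rewrite (_ : _ - _ = - (s - t)) ?normrN//; ring.
Qed.

Lemma path_length_rev g : (path_length d (rev_path01 g) <= path_length d g)%E.
Proof.
apply: path_length_le => s [sorted_s /allP s01].
have -> : poly_sum d (rev_path01 g) s = poly_sum d g (rev [seq 1 - t | t <- s]).
  by rewrite !poly_sum_chain_length map_rev chain_length_rev -map_comp.
apply: poly_sum_le_length; split.
  rewrite rev_sorted sorted_map; apply: sub_sorted sorted_s => t u /=; lra.
by rewrite all_rev all_map; apply/allP => t /s01 /=; lra.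
Qed.

Definition concat_path g h : R -> X :=
  fun t => if t <= 2^-1 then g (2 * t) else h (2 * t - 1).

Lemma concat_path0 g h : concat_path g h 0 = g 0.
Proof. by rewrite /concat_path ifT ?mulr0//; lra. Qed.

Lemma concat_path1 g h : concat_path g h 1 = h 1.
Proof. by rewrite /concat_path ifF; [congr h; lra|apply/negP; lra]. Qed.

Lemma cont_path_affine g (m c s e : R) : cont_path d g -> 0 < e ->
  0 < m -> 0 <= m * s - c <= 1 ->
  exists2 r, 0 < r & forall t, 0 <= m * t - c <= 1 -> `|s - t| < r ->
    d (g (m * s - c)) (g (m * t - c)) < e.
Proof.
move=> cont_g e0 m0 /cont_g/(_ e e0)[r r0 near_s].
exists (r / m) => [|t t01 st]; first by rewrite divr_gt0.
apply: near_s => //; rewrite (_ : _ - _ = m * (s - t)); last by ring.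
by rewrite normrM gtr0_norm// mulrC -ltr_pdivlMr.
Qed.

Lemma cont_path_concat g h : g 1 = h 0 ->
  cont_path d g -> cont_path d h -> cont_path d (concat_path g h).
Proof.
move=> gh cont_g cont_h s s01 e e0; rewrite /concat_path.
have near_g t := cont_path_affine (c := 0) (s := t) cont_g e0 (ltr0Sn R 1).
have near_h t := cont_path_affine (c := 1) (s := t) cont_h e0 (ltr0Sn R 1).
case: (ltrgtP s 2^-1) => s2.
- have [|r r0 near_s] := near_g s; first by lra.
  exists (Num.min r (2^-1 - s)); first by rewrite lt_min r0 subr_gt0.
  move=> t t01; rewrite lt_min => /andP[st]; rewrite ltr_distlC => t2.
  rewrite ifT; last by lra.
  by have := near_s t ltac:(lra) st; rewrite !subr0.
- have [|r r0 near_s] := near_h s; first by lra.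
  exists (Num.min r (s - 2^-1)); first by rewrite lt_min r0 subr_gt0.
  move=> t t01; rewrite lt_min => /andP[st]; rewrite ltr_distl => t2.
  rewrite ifF; last by apply/negP; lra.
  by apply: near_s => //; lra.
- have [|r1 r10 near1] := near_g s; first by lra.
  have [|r2 r20 near2] := near_h s; first by lra.
  exists (Num.min r1 r2); first by rewrite lt_min r10.
  move=> t t01; rewrite lt_min => /andP[st1 st2]; case: ifPn => t2.
    by have := near1 t ltac:(lra) st1; rewrite !subr0.
  have -> : g (2 * s) = h (2 * s - 1) by rewrite s2 mulfV// subrr.
  by apply: near2 => //; lra.
Qed.

Definition first_half (s : seq R) : seq R :=
  rcons [seq 2 * t | t <- s & t <= 2^-1] 1.

Definition second_half (s : seq R) : seq R :=
  0 :: [seq 2 * t - 1 | t <- s & 2^-1 < t].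

Lemma first_half_partition s : partition01 s -> partition01 (first_half s).
Proof.
case=> sorted_s /allP s01; split.
  rewrite le_sorted_pairwise pairwise_rcons pairwise_map; apply/andP; split.
    by apply/allP => _ /mapP[t + ->]; rewrite mem_filter => /andP[? _]; lra.
  apply: pairwise_filter; move: sorted_s; rewrite le_sorted_pairwise.
  by apply: sub_pairwise => t u /=; lra.
rewrite all_rcons; apply/andP; split; first by lra.
by apply/allP => _ /mapP[t + ->]; rewrite mem_filter => /andP[? /s01]; lra.
Qed.

Lemma second_half_partition s : partition01 s -> partition01 (second_half s).
Proof.
case=> sorted_s /allP s01; split.
  rewrite le_sorted_pairwise /= pairwise_map; apply/andP; split.
    by apply/allP => _ /mapP[t + ->]; rewrite mem_filter => /andP[? _]; lra.
  apply: pairwise_filter; move: sorted_s; rewrite le_sorted_pairwise.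
  by apply: sub_pairwise => t u /=; lra.
apply/andP; split; first by lra.
by apply/allP => _ /mapP[t + ->]; rewrite mem_filter => /andP[? /s01]; lra.
Qed.

Lemma poly_sum_concat_le g h s : g 1 = h 0 -> sorted <=%R s ->
  poly_sum d (concat_path g h) s <=
    poly_sum d g (first_half s) + poly_sum d h (second_half s).
Proof.
move=> gh sorted_s; rewrite !poly_sum_chain_length.
rewrite -[s in map _ s](cat_take_drop (count (<= 2^-1) s)).
rewrite -sorted_filter_le// -sorted_filter_gt// map_cat.
have -> : [seq concat_path g h t | t <- s & t <= 2^-1] =
          map g [seq 2 * t | t <- s & t <= 2^-1].
  rewrite -map_comp; apply/eq_in_map => t; rewrite mem_filter => /andP[t2 _].
  by rewrite /concat_path t2.
have -> : [seq concat_path g h t | t <- s & 2^-1 < t] =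
          map h [seq 2 * t - 1 | t <- s & 2^-1 < t].
  rewrite -map_comp; apply/eq_in_map => t; rewrite mem_filter => /andP[t2 _].
  by rewrite /concat_path leNgt t2.
rewrite /first_half /second_half map_rcons map_cons gh -chain_length_cat.
exact: chain_length_insert.
Qed.

Lemma path_length_concat g h : g 1 = h 0 ->
  (path_length d (concat_path g h) <= path_length d g + path_length d h)%E.
Proof.
move=> gh; apply: path_length_le => s part_s.
apply: (@le_trans _ _ (poly_sum d g (first_half s) + poly_sum d h (second_half s))%:E).
  by rewrite lee_fin; apply: poly_sum_concat_le gh part_s.1.
rewrite EFinD; apply: leeD; apply: poly_sum_le_length.
  exact: first_half_partition.
exact: second_half_partition.
Qed.

Lemma cont_path_unif g e : cont_path d g -> 0 < e -> exists n : nat,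
  forall s t, 0 <= s <= 1 -> 0 <= t <= 1 -> `|s - t| <= n.+1%:R^-1 -> d (g s) (g t) < e.
Proof.
move=> cont_g e0.
have /compact_near_coveringP/near_covering_withinP := @segment_compact R 0 1.
pose fine (n : nat) s :=
  forall t, 0 <= t <= 1 -> `|s - t| <= n.+1%:R^-1 -> d (g s) (g t) < e.
move=> /(_ _ \oo fine _)[|n _ fine_n]; last first.
  by exists n => s t s01; apply: fine_n => //=; rewrite in_itv.
move=> s /=; rewrite in_itv /= => s01.
have [|r r0 near_s] := cont_g s s01 (e / 2); first by lra.
have r2 : 0 < r / 2 by lra.
near=> s' n; rewrite /= in_itv /= => s'01 t t01 s't.
have ss' : `|s - s'| < r / 2 by near: s'; exact: nbhsx_ballx.
have nr : n.+1%:R^-1 < r / 2 by near: n; exact: (near_infty_natSinv_lt (PosNum r2)).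
have st : `|s - t| < r.
  by rewrite [r]splitr (le_lt_trans (ler_distD s' _ _))// ltrD// (le_lt_trans s't).
have := near_s t t01 st; have := near_s s' s'01 ltac:(lra).
by have := dist_triangle (g s) (g s') (g t); rewrite (dist_sym (g s') (g s)); lra.
Unshelve. all: by end_near. Qed.

Lemma fine_partition g e : cont_path d g -> 0 < e -> exists s : seq R,
  [/\ partition01 (0 :: s), last 0 s = 1 & path (fun t t' => d (g t) (g t') <= e) 0 s].
Proof.
move=> cont_g e0; have [n fine_n] := cont_path_unif cont_g e0.
pose node (i : nat) : R := i%:R / n.+1%:R.
have n0 : 0 < n.+1%:R :> R by [].
have node01 i : (i < n.+2)%N -> 0 <= node i <= 1.
  by move=> ?; rewrite divr_ge0//= ler_pdivrMr// mul1r ler_nat.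
have step i : node i.+1 = node i + n.+1%:R^-1 by rewrite /node -natr1 mulrDl mul1r.
pose nodes := mkseq (fun i => node i.+1) n.+1.
have nodeE i : (i < n.+1)%N -> nth 0 (0 :: nodes) i = node i.
  by case: i => [|i] ltin; [rewrite /node mul0r|rewrite [LHS]nth_mkseq// ltnW].
exists nodes; split.
- split.
    apply/(pathP 0) => i; rewrite size_mkseq => ltin.
    by rewrite nodeE// nth_mkseq// step lerDl invr_ge0.
  apply/allP => t; rewrite in_cons => /predU1P[->|/mapP[i + ->]]; first by lra.
  by rewrite mem_iota => ?; apply: node01; lia.
- by rewrite -nth_last size_mkseq nth_mkseq// /node divff.
- apply/(pathP 0) => i; rewrite size_mkseq => ltin.
  rewrite nodeE// nth_mkseq//; apply/ltW/fine_n; rewrite ?node01//; first by lia.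
  by rewrite step opprD addNKr normrN ger0_norm// invr_ge0.
Qed.

Definition outside_path r p x y g : Prop :=
  cont_path d g /\ g 0 = x /\ g 1 = y /\ forall t, 0 <= t <= 1 -> r <= d p (g t).

Lemma dS_le_length r p x y g :
  outside_path r p x y g -> (dS d r p x y <= path_length d g)%E.
Proof.
by move=> out_g; apply: ge_ereal_inf; exists (path_length d g) => //; exists g.
Qed.

Lemma dS_le_lipschitz r p L g : lipschitz01 L g ->
  (forall t, 0 <= t <= 1 -> r <= d p (g t)) -> (dS d r p (g 0%R) (g 1%R) <= L%:E)%E.
Proof.
move=> lip_g out_g; apply: le_trans (lipschitz_path_length lip_g).
by apply: dS_le_length; split; first exact: lipschitz_cont_path lip_g.
Qed.

Lemma dS_sym r p x y : dS d r p x y = dS d r p y x.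
Proof.
suff dS_rev u v : (dS d r p u v <= dS d r p v u)%E by apply/eqP; rewrite eq_le !dS_rev.
apply/ereal_infP => _ [g [cont_g [g0 [g1 out_g]]] <-].
apply: le_trans (path_length_rev g); apply: dS_le_length.
split; first exact: cont_path_rev.
rewrite /rev_path01 subr0 subrr; do 2 split=> //.
by move=> t t01; apply: out_g; lra.
Qed.

Lemma dS_triangle r p y x z : (dS d r p x z <= dS d r p x y + dS d r p y z)%E.
Proof.
apply: le_ereal_infD => [_ [g _ <-]|_ [g _ <-]|]; try exact: path_length_ge0.
move=> _ [g [cont_g [g0 [g1 out_g]]] <-] _ [h [cont_h [h0 [h1 out_h]]] <-].
have gh : g 1 = h 0 by rewrite g1 h0.
apply: le_trans (path_length_concat gh); apply: dS_le_length.
split; first exact: cont_path_concat.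
rewrite concat_path0 concat_path1; do 2 split=> //.
by move=> t t01; rewrite /concat_path; case: ifPn => ?; [apply: out_g|apply: out_h]; lra.
Qed.

Lemma dS_le_diam r p (A : set X) x y : A x -> A y -> (dS d r p x y <= diamS d r p A)%E.
Proof. by move=> Ax Ay; apply: ereal_sup_ubound; exists x => //; exists y. Qed.

Lemma diamS_le r p (A : set X) (M : \bar R) :
  (forall x y, A x -> A y -> (dS d r p x y <= M)%E) -> (diamS d r p A <= M)%E.
Proof. by move=> AM; apply: ge_ereal_sup => _ [x Ax [y Ay <-]]; apply: AM. Qed.

Lemma diamS_subset r p (A B : set X) : A `<=` B -> (diamS d r p A <= diamS d r p B)%E.
Proof. by move=> AB; apply: diamS_le => x y /AB Bx /AB By; apply: dS_le_diam. Qed.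

(** * Gromov products and geodesics *)

Lemma gromov_sym w y z : gromov d w y z = gromov d w z y.
Proof. by rewrite /gromov (dist_sym z y); lra. Qed.

Lemma gromov_diag w y : gromov d w y y = d w y.
Proof. by rewrite /gromov dist_refl; lra. Qed.

Lemma gromov_base w y : gromov d w y w = 0.
Proof. by rewrite /gromov dist_refl (dist_sym y w); lra. Qed.

Lemma gromov_compl x y z : gromov d x y z = d x y - gromov d y x z.
Proof. by rewrite /gromov (dist_sym y x); lra. Qed.

Lemma gromov_ge0 w y z : 0 <= gromov d w y z.
Proof. by have := dist_triangle w y z; rewrite /gromov (dist_sym y w); lra. Qed.

Lemma gromov_lel w y z : gromov d w y z <= d w y.
Proof. by have := gromov_ge0 y w z; rewrite (gromov_compl w y z); lra. Qed.

Lemma gromov_ler w y z : gromov d w y z <= d w z.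
Proof. by rewrite gromov_sym gromov_lel. Qed.

Lemma geodesic_rev x y g : geodesic d x y g -> geodesic d y x (fun t => g (d x y - t)).
Proof.
move=> [g0 [g1 g_iso]]; rewrite /geodesic (dist_sym y x) subr0 subrr.
do 2 split=> //; move=> s t ? ?; rewrite g_iso; [|lra|lra].
by rewrite distrC; congr `| _ |; ring.
Qed.

Lemma geodesic_sub x y g s t : geodesic d x y g -> 0 <= s -> s <= t -> t <= d x y ->
  geodesic d (g s) (g t) (fun t' => g (s + t')) /\ d (g s) (g t) = t - s.
Proof.
move=> [g0 [g1 g_iso]] s0 st td.
have dst : d (g s) (g t) = t - s by rewrite g_iso ?ler0_norm; lra.
split=> //; rewrite /geodesic dst addr0; split=> //; split; first by congr g; ring.
move=> v w ? ?; rewrite g_iso; [|lra|lra].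
by congr `| _ |; ring.
Qed.

Lemma geodesic_distl x y g t : geodesic d x y g -> 0 <= t <= d x y -> d x (g t) = t.
Proof.
move=> geod_g /andP[t0 td]; have [g0 _] := geod_g.
by have [_] := geodesic_sub geod_g (lexx 0) t0 td; rewrite g0 subr0.
Qed.

Lemma geodesic_distr x y g t :
  geodesic d x y g -> 0 <= t <= d x y -> d (g t) y = d x y - t.
Proof.
move=> geod_g /andP[t0 td]; have [_ [g1 _]] := geod_g.
by have [_] := geodesic_sub geod_g t0 td (lexx _); rewrite g1.
Qed.

Definition on_segment x y p : Prop :=
  exists g t, [/\ geodesic d x y g, 0 <= t <= d x y & g t = p].

Lemma on_segment_sym x y p : on_segment x y p -> on_segment y x p.
Proof.
move=> [g [t [geod_g t_itv <-]]]; exists (fun t => g (d x y - t)), (d x y - t).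
split; first exact: geodesic_rev.
  by rewrite (dist_sym y x); lra.
by congr g; ring.
Qed.

Lemma on_segment_dist x y p : on_segment x y p -> d x p + d p y = d x y.
Proof.
move=> [g [t [geod_g t_itv <-]]].
by rewrite (geodesic_distl geod_g t_itv) (geodesic_distr geod_g t_itv); ring.
Qed.

Lemma on_subsegment x y g (s t u : R) : geodesic d x y g ->
  0 <= s -> s <= t -> t <= u -> u <= d x y -> on_segment (g s) (g u) (g t).
Proof.
move=> geod_g s0 st tu ud.
have [geod_su dsu] := geodesic_sub geod_g s0 (le_trans st tu) ud.
exists (fun t => g (s + t)), (t - s); split=> //; first by rewrite dsu; lra.
by congr g; ring.
Qed.

Lemma dS_le_geodesic r p x y g : geodesic d x y g ->
  (forall t, 0 <= t <= d x y -> r <= d p (g t)) -> (dS d r p x y <= (d x y)%:E)%E.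
Proof.
move=> [g0 [g1 g_iso]] out_g; have xy0 := dist_ge0 x y.
pose k t := g (t * d x y).
have k0 : k 0 = x by rewrite /k mul0r.
have k1 : k 1 = y by rewrite /k mul1r.
rewrite -{1}k0 -{1}k1; apply: dS_le_lipschitz => [s t ? ?|t t01]; last first.
  by apply: out_g; nra.
by rewrite /k g_iso; [rewrite -mulrBl normrM (ger0_norm xy0) mulrC|nra|nra].
Qed.

Lemma dS_radial_le r p a g s t : geodesic d p a g ->
  0 <= s -> r <= s -> s <= t -> t <= d p a -> (dS d r p (g s) (g t) <= (t - s)%:E)%E.
Proof.
move=> geod_g s0 rs st ta; have [geod_st dst] := geodesic_sub geod_g s0 st ta.
rewrite -dst; apply: dS_le_geodesic geod_st _ => u; rewrite dst => u_itv.
by rewrite (geodesic_distl geod_g); lra.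
Qed.

(** * Hyperbolic spaces *)

Section Hyperbolic.
Variable delta : R.
Hypothesis geod_d : geodesic_space d.
Hypothesis delta_gt0 : 0 < delta.
Hypothesis hyp_d : hyperbolic d delta.

Lemma geodesics_fellow_travel p a b g h t : geodesic d p a g -> geodesic d p b h ->
  0 <= t <= gromov d p a b -> d (g t) (h t) <= delta.
Proof.
move=> geod_g geod_h t_itv; have [k geod_k] := geod_d a b.
have [+ _] := hyp_d geod_g geod_k (geodesic_rev geod_h).
by move=> /(_ t t_itv); rewrite (dist_sym b p) (_ : _ - (_ - t) = t)//; ring.
Qed.

Lemma gromov_four_point y p x z :
  Num.min (gromov d p x y) (gromov d p y z) - delta <= gromov d p x z.
Proof.
have [gx geod_gx] := geod_d p x; have [gy geod_gy] := geod_d p y.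
have [gz geod_gz] := geod_d p z; set m := Num.min _ _.
have m0 : 0 <= m by rewrite le_min !gromov_ge0.
have mxy : 0 <= m <= gromov d p x y by rewrite m0 ge_min lexx.
have myz : 0 <= m <= gromov d p y z by rewrite m0 ge_min lexx orbT.
have mx : 0 <= m <= d p x by have := gromov_lel p x y; lra.
have mz : 0 <= m <= d p z by have := gromov_ler p y z; lra.
have gxy := geodesics_fellow_travel geod_gx geod_gy mxy.
have gyz := geodesics_fellow_travel geod_gy geod_gz myz.
have := geodesic_distr geod_gx mx; have := geodesic_distr geod_gz mz.
have := dist_triangle (gx m) x z; have := dist_triangle (gy m) (gx m) z.
have := dist_triangle (gz m) (gy m) z; rewrite (dist_sym x (gx m)).
by rewrite /gromov; lra.
Qed.

Lemma gromov_lt_of_close p x y z t :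
  t + delta <= gromov d p y z -> gromov d p x z < t -> gromov d p x y < t + delta.
Proof.
move=> yz; apply: contraTT; rewrite -!leNgt => xy.
by apply: le_trans (gromov_four_point y _ _ _); rewrite lerBrDr le_min xy.
Qed.

Lemma gromov_ge_of_close w p x z t :
  t + delta <= gromov d p w x -> t + delta <= gromov d p w z -> t <= gromov d p x z.
Proof.
move=> wx wz; apply: le_trans (gromov_four_point w p x z).
by rewrite lerBrDr le_min wz (gromov_sym p x) wx.
Qed.

Lemma slim_triangle z x y p : on_segment x y p ->
  exists2 q, on_segment x z q \/ on_segment z y q & d p q <= delta.
Proof.
move=> [g [t [geod_g t_itv <-]]].
have [gx geod_gx] := geod_d x z; have [gy geod_gy] := geod_d y z.
have [txy|xyt] := lerP t (gromov d x y z).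
  exists (gx t); last by apply: geodesics_fellow_travel geod_g geod_gx _; lra.
  by left; exists gx, t; split=> //; have := gromov_ler x y z; lra.
have u_itv : 0 <= d x y - t <= gromov d y x z.
  by rewrite (gromov_compl y) (dist_sym y); lra.
exists (gy (d x y - t)).
  right; apply: on_segment_sym; exists gy, (d x y - t); split=> //.
  by have := gromov_ler y x z; lra.
have := geodesics_fellow_travel (geodesic_rev geod_g) geod_gy u_itv.
by rewrite (_ : d x y - (d x y - t) = t)//; ring.
Qed.

(* Halving the chain costs [delta] by slimness and [e] in length, since the
   chain need not pass through its midpoint; [2 * e] is the fixed point of
   [l |-> l / 2 + e], so the excess over it halves at each step. *)
Lemma chain_near_segment N e D x s p : 0 <= e ->
  path (fun u v => d u v <= e) x s -> chain_length (x :: s) <= 2 * e + D ->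
  on_segment x (last x s) p ->
  has (fun q => d p q <= delta * N%:R + e + D / 2 ^+ N.+1) (x :: s).
Proof.
move=> e0; elim: N D x s p => [|N IH] D x s p path_s len_s seg_p.
  have xpl := on_segment_dist seg_p; have xl := dist_le_chain_length x s.
  rewrite mulr0 expr1 add0r.
  have [//|px] := boolP (d p x <= e + D / 2); first by rewrite /= => ->.
  by rewrite lastI has_rcons; apply/orP; left; rewrite (dist_sym x) in xpl *; lra.
have len0 := chain_length_ge0 (x :: s).
have [|s1 [s2 [def_s len1 len2]]] :=
  chain_split (t := chain_length (x :: s) / 2) e0 _ path_s; first by lra.
have [q seg_q pq] := slim_triangle (last x s1) seg_p.
have closer z : d q z <= delta * N%:R + e + D / 2 / 2 ^+ N.+1 ->
    d p z <= delta * N.+1%:R + e + D / 2 ^+ N.+2.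
  rewrite [2 ^+ N.+2]exprS invfM mulrA -(natr1 N).
  by have := dist_triangle q p z; lra.
move: path_s; rewrite def_s cat_path => /andP[path1 path2].
case: seg_q => [seg1|seg2].
  have := IH (D / 2) _ _ _ path1 ltac:(lra) seg1; move/(sub_has closer).
  by rewrite -cat_cons has_cat => ->.
rewrite def_s last_cat in seg2.
have := IH (D / 2) _ _ _ path2 ltac:(lra) seg2; move/(sub_has closer).
by rewrite -cat_cons (lastI x) cat_rcons has_cat => ->; rewrite orbT.
Qed.

Lemma path_length_ge_exp D p k : cont_path d k -> on_segment (k 0) (k 1) p ->
  0 <= D -> (forall t, 0 <= t <= 1 -> D + 1 <= d p (k t)) ->
  ((powR 2 (D / delta))%:E <= path_length d k)%E.
Proof.
move=> cont_k seg_p D0 out_k; set P := powR _ _.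
have Ddelta : 0 <= D / delta by rewrite divr_ge0// ltW.
pose N := Num.trunc (D / delta).
have ND : delta * N%:R <= D.
  by rewrite mulrC -ler_pdivlMr//; have /andP[] := truncn_itv Ddelta.
have PN : P < 2 ^+ N.+1 by apply: powR_lt_exprn_truncS; rewrite ?ltr1n.
have Q0 : 0 < (2 : R) ^+ N.+1 by rewrite exprn_gt0.
pose e := 1 - P / 2 ^+ N.+1.
have e0 : 0 < e by rewrite subr_gt0 ltr_pdivrMr// mul1r.
have [s [part_s last_s fine_s]] := fine_partition cont_k e0.
apply: le_trans (poly_sum_le_length k part_s).
rewrite poly_sum_chain_length lee_fin; set len := chain_length _.
have : has (fun q => d p q <= delta * N%:R + e + (len - 2 * e) / 2 ^+ N.+1)
           (map k (0 :: s)).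
  apply: chain_near_segment; rewrite ?path_map ?last_map ?last_s//; first exact: ltW.
  by rewrite /len; lra.
rewrite has_map => /hasP[t ts /= pkt].
have t01 : 0 <= t <= 1 by case: part_s => _ /allP/(_ t ts).
have : P / 2 ^+ N.+1 <= len / 2 ^+ N.+1.
  have : (len - 2 * e) / 2 ^+ N.+1 <= len / 2 ^+ N.+1.
    by rewrite ler_pM2r ?invr_gt0//; lra.
  by have := out_k t t01; rewrite /e in pkt *; lra.
by rewrite ler_pM2r ?invr_gt0.
Qed.

Lemma dS_ge_exp r a u v c : 2 <= r -> on_segment u v c -> d a c <= 1 ->
  ((powR 2 ((r - 2) / delta))%:E <= dS d r a u v)%E.
Proof.
move=> r2 seg_c ac; apply/ereal_infP => _ [k [cont_k [k0 [k1 out_k]]] <-].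
apply: (path_length_ge_exp (p := c)) => //; rewrite ?k0 ?k1 ?subr_ge0// => t t01.
by have := out_k t t01; have := dist_triangle c a (k t); lra.
Qed.

Lemma dS_le_short r p x y e : d x y <= e -> r + e <= d p x -> (dS d r p x y <= e%:E)%E.
Proof.
move=> xye px; have [g geod_g] := geod_d x y.
apply: (le_trans (y := (d x y)%:E)); last by rewrite lee_fin.
apply: (dS_le_geodesic geod_g) => t t_itv; have := dist_triangle (g t) p x.
by rewrite (dist_sym (g t)) (geodesic_distl geod_g t_itv); lra.
Qed.

(* Move [g r] and [h r] radially outwards by [delta], where the fellow travelling
   geodesics can be joined without entering the ball. *)
Lemma dS_sproj_le r p a b x y : 0 <= r -> r + delta <= gromov d p a b ->
  sproj d r p a x -> sproj d r p b y -> (dS d r p x y <= (3 * delta)%:E)%E.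
Proof.
move=> r0 rab [g [geod_g <-]] [h [geod_h <-]]; have delta0 := delta_gt0.
have ra := gromov_lel p a b; have rb := gromov_ler p a b.
have radial c k : geodesic d p c k -> r + delta <= d p c ->
    (dS d r p (k r) (k (r + delta)%R) <= delta%:E)%E.
  move=> geod_k rc.
  by apply: le_trans (dS_radial_le geod_k _ _ _ _) _; rewrite ?lee_fin; lra.
rewrite (_ : 3 * delta = delta + (delta + delta)); last by ring.
apply: le_trans (dS_triangle _ _ (g (r + delta)) _ _) _; rewrite EFinD leeD//.
  by apply: radial geod_g _; lra.
apply: le_trans (dS_triangle _ _ (h (r + delta)) _ _) _; rewrite EFinD leeD//.
  apply: dS_le_short; last by rewrite (geodesic_distl geod_g); lra.
  by apply: geodesics_fellow_travel geod_g geod_h _; lra.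
by rewrite dS_sym; apply: radial geod_h _; lra.
Qed.

Lemma dproj_sproj_le r p a b : 0 <= r -> r + delta <= gromov d p a b ->
  (dproj d r (sproj d r) p a b <= (3 * delta)%:E)%E.
Proof.
move=> r0 rab; have rba := rab; rewrite gromov_sym in rba.
have ra := gromov_lel p a b; have rb := gromov_ler p a b.
apply: diamS_le => x y [px|px] [py|py]; apply: dS_sproj_le px py => //;
  by rewrite gromov_diag; lra.
Qed.

Lemma dS_sproj_side_le r a b c k x : 0 <= r -> r + delta <= d a b ->
  geodesic d b c k -> d a b - (r + delta) <= gromov d b a c -> sproj d r a b x ->
  (dS d r a x (k (d a b - (r + delta))%R) <= (2 * delta)%:E)%E.
Proof.
move=> r0 rb geod_k abc [g [geod_g <-]]; have delta0 := delta_gt0.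
rewrite (_ : 2 * delta = delta + delta); last by ring.
apply: le_trans (dS_triangle _ _ (g (r + delta)) _ _) _; rewrite EFinD leeD//.
  by apply: le_trans (dS_radial_le geod_g _ _ _ _) _; rewrite ?lee_fin; lra.
apply: dS_le_short; last by rewrite (geodesic_distl geod_g); lra.
have := geodesics_fellow_travel (t := d a b - (r + delta)) (geodesic_rev geod_g) geod_k.
by rewrite (_ : d a b - (_ - _) = r + delta); [apply; lra|ring].
Qed.

Lemma dS_sproj_ge_exp r a b c p x y : 2 <= r -> on_segment b c p -> d p a <= 1 ->
  r + delta <= d a b -> r + delta <= d a c -> sproj d r a b x -> sproj d r a c y ->
  ((powR 2 ((r - 2) / delta) - 4 * delta)%:E <= dS d r a x y)%E.
Proof.
move=> r2 [k [t [geod_k t_itv <-]]] ka rb rc px py; have delta0 := delta_gt0.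
have bk := geodesic_distl geod_k t_itv; have kc := geodesic_distr geod_k t_itv.
have := dist_triangle (k t) a b; have := dist_triangle (k t) a c.
rewrite (dist_sym a (k t)) kc (dist_sym (k t) b) bk => ac ab.
have tri := dist_triangle a b c; rewrite (dist_sym b a) in tri.
pose s := d a b - (r + delta); pose s' := d b c - (d a c - (r + delta)).
have xs : (dS d r a x (k s) <= (2 * delta)%:E)%E.
  by apply: dS_sproj_side_le geod_k _ px => //; rewrite /gromov ?(dist_sym b a); lra.
have ys : (dS d r a y (k s') <= (2 * delta)%:E)%E.
  apply: dS_sproj_side_le (geodesic_rev geod_k) _ py => //; first by lra.
  by rewrite /gromov (dist_sym c a) (dist_sym c b); lra.
have seg : on_segment (k s) (k s') (k t).
  by apply: on_subsegment geod_k _ _ _ _; rewrite /s /s'; lra.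
rewrite EFinB leeBlDr// (_ : 4 * delta = 2 * delta + 2 * delta); last by ring.
apply: le_trans (dS_ge_exp (a := a) r2 seg _) _; first by rewrite dist_sym.
rewrite EFinD addeA; apply: le_trans (dS_triangle _ _ y _ _) _; apply: leeD => //.
by rewrite addeC; apply: le_trans (dS_triangle _ _ x _ _) _; rewrite dS_sym leeD2r.
Qed.

(* Apices whose feet on [g] agree up to [s - 2 * D] would be closer than [s]. *)
Lemma finite_separated_near_geodesic x z g (A : set X) (foot : X -> R) (s D : R) :
  geodesic d x z g -> rho_separated d s A -> 2 * D < s ->
  (forall y, A y -> 0 <= foot y <= d x z /\ d y (g (foot y)) <= D) -> finite_set A.
Proof.
move=> [_ [_ g_iso]] sepA Ds near_g.
have e0 : 0 < s - 2 * D by lra.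
pose cell y := Num.trunc (foot y / (s - 2 * D)).
have cellP y : A y -> (cell y)%:R * (s - 2 * D) <= foot y < (cell y).+1%:R * (s - 2 * D).
  move=> Ay; have [y_itv _] := near_g y Ay.
  have : 0 <= foot y / (s - 2 * D) by apply: divr_ge0; lra.
  by move=> /truncn_itv; rewrite ler_pdivlMr// ltr_pdivrMr.
have cell_inj : {in A &, injective cell}.
  move=> y y' /set_mem Ay /set_mem Ay' eq_cell; apply: contrapT => yy'.
  have [y_itv ygy] := near_g y Ay; have [y'_itv y'gy'] := near_g y' Ay'.
  have feet : d (g (foot y)) (g (foot y')) < s - 2 * D.
    have := cellP _ Ay; have := cellP _ Ay'; rewrite g_iso// -eq_cell -natr1.
    by rewrite mulrDl mul1r ltr_distlC; lra.
  have := sepA _ _ Ay Ay' yy'; have := dist_triangle (g (foot y)) y y'.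
  have := dist_triangle (g (foot y')) (g (foot y)) y'.
  by rewrite (dist_sym (g (foot y')) y'); lra.
rewrite -(eq_finite_set (inj_card_eq cell_inj)).
apply: (@sub_finite_set _ _ `I_(Num.trunc (d x z / (s - 2 * D))).+1).
  move=> _ [y Ay <-] /=; rewrite ltnS; apply: le_truncn.
  by rewrite ler_pM2r ?invr_gt0//; have [] := near_g y Ay; lra.
exact: finite_II.
Qed.

(** * Projections between separated apices *)

Section Apices.
Variables (r : R) (C : set X).
Hypothesis r_ge0 : 0 <= r.
Hypothesis sep_C : rho_separated d (2 * r + 6 * delta) C.

Local Notation pi := (sproj d r).

Lemma gromov_lt_of_dproj p a b :
  ((3 * delta)%:E < dproj d r pi p a b)%E -> gromov d p a b < r + delta.
Proof. by rewrite !ltNge; apply: contraNN => rab; apply: dproj_sproj_le. Qed.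

Lemma gromov_ge_of_opposite a p b t : C a -> C p -> a <> p ->
  gromov d a p b <= t -> 2 * r + 6 * delta - t <= gromov d p a b.
Proof.
by move=> Ca Cp ap apb; have := sep_C Ca Cp ap; rewrite (gromov_compl p) dist_sym; lra.
Qed.

Lemma diamS_sproj_le p a : C p -> C a -> a <> p ->
  (diamS d r p (pi p a) <= (3 * delta)%:E)%E.
Proof.
move=> Cp Ca ap; rewrite -[pi p a]setUid; apply: dproj_sproj_le => //.
have := sep_C Ca Cp ap; have delta0 := delta_gt0; have r0 := r_ge0.
by rewrite gromov_diag dist_sym; lra.
Qed.

Lemma behrstock_inequality x y z : C x -> C y -> x <> y ->
  ((3 * delta)%:E < dproj d r pi y x z)%E ->
  (dproj d r pi x y z <= (3 * delta)%:E)%E.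
Proof.
move=> Cx Cy xy /gromov_lt_of_dproj/ltW yxz; have delta0 := delta_gt0.
apply: dproj_sproj_le => //.
by have := gromov_ge_of_opposite Cy Cx (nesym xy) yxz; lra.
Qed.

Lemma finite_large_projections x z :
  finite_set [set y | C y /\ y <> x /\ y <> z /\
    ((3 * delta)%:E < dproj d r pi y x z)%E].
Proof.
have delta0 := delta_gt0; have [g geod_g] := geod_d x z.
apply: (@finite_separated_near_geodesic x z g _ (fun y => gromov d x y z)
  (2 * r + 6 * delta) (r + 2 * delta) geod_g); [|by lra|].
  by move=> y y' [Cy _] [Cy' _]; apply: sep_C.
move=> y [_ [_ [_ /gromov_lt_of_dproj yxz]]]; have [h geod_h] := geod_d x y.
have t0 := gromov_ge0 x y z; have ty := gromov_lel x y z; have tz := gromov_ler x y z.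
split; first by rewrite t0.
have := geodesics_fellow_travel (t := gromov d x y z) geod_h geod_g ltac:(lra).
have := geodesic_distr (t := gromov d x y z) geod_h ltac:(lra).
have := dist_triangle (h (gromov d x y z)) y (g (gromov d x y z)).
by move: yxz; rewrite (dist_sym y (h _)) (gromov_compl y x z) (dist_sym y x); lra.
Qed.

Lemma sproj_projection_axioms : projection_axioms d r C pi (3 * delta).
Proof.
split; first exact: diamS_sproj_le.
split=> [x y z Cx Cy _ xy _ _|x z _ _]; first exact: behrstock_inequality.
exact: finite_large_projections.
Qed.

(** * Shadows and the upgraded projections *)

(* If [(y|v)_u] is small, a geodesic from [y] to [v] passes near [u]: the apex [v]
   lies in the shadow of [u] as seen from [y]. *)
Definition shadow_adj y u v : bool :=
  (gromov d u y v < r + delta) || (gromov d v y u < r + delta).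

Lemma gromov_ge_of_nearer m w y : C m -> C w -> m <> w -> d y m <= d y w ->
  r + 3 * delta <= gromov d w y m.
Proof.
move=> Cm Cw mw; have := sep_C Cm Cw mw.
by rewrite /gromov (dist_sym w y) (dist_sym w m) (dist_sym y m); lra.
Qed.

(* The loss [delta] is not accumulated along a zigzag: [w'] and [w] are both close
   to [m'] as seen from [m], so only the adjacency of [m] and [w'] matters. *)
Lemma shadow_of_nearer y m m' w' w : C m -> C m' -> C w' ->
  d y m <= d y m' -> d y m <= d y w' -> shadow_adj y m w' ->
  gromov d m' y w' < r + 2 * delta -> gromov d m' y w < r + 2 * delta ->
  gromov d m y w < r + 2 * delta.
Proof.
move=> Cm Cm' Cw' ymm' ymw' adj m'w' m'w; have delta0 := delta_gt0; have r0 := r_ge0.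
have [->//|mm'] := pselect (m = m').
have mw' : gromov d m y w' < r + delta.
  case/orP: adj => // w'm; have [<-|m_ne] := pselect (m = w').
    by rewrite gromov_base; lra.
  by have := gromov_ge_of_nearer Cm Cw' m_ne ymw'; lra.
have beyond v : gromov d m' y v < r + 2 * delta -> r + 3 * delta <= gromov d m m' v.
  move=> m'v; have m'mv : gromov d m' m v < r + 3 * delta.
    have -> : r + 3 * delta = r + 2 * delta + delta by ring.
    rewrite gromov_sym; apply: (gromov_lt_of_close (z := y)); last by rewrite gromov_sym.
    by have := gromov_ge_of_nearer Cm Cm' mm' ymm'; rewrite gromov_sym; lra.
  by have := gromov_ge_of_opposite Cm' Cm (nesym mm') (ltW m'mv); lra.
have -> : r + 2 * delta = r + delta + delta by ring.
apply: gromov_lt_of_close mw'; apply: (gromov_ge_of_close (w := m')).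
  by have := beyond _ m'w; lra.
by have := beyond _ m'w'; lra.
Qed.

Definition zigzag y (s : seq X) : bool :=
  sorted (shadow_adj y) s && all (mem (C `\ y)) s.

Lemma zigzag_outwards y l m s :
  zigzag y (rev l ++ m :: s) = zigzag y (m :: l) && zigzag y (m :: s).
Proof.
rewrite /zigzag sorted_cat_cons -rev_cons rev_sorted all_cat all_rev /=.
rewrite (eq_path (e' := shadow_adj y)); last by move=> u v; rewrite /shadow_adj orbC.
by case: (path _ _ l); case: (path _ _ s); case: (_ \in _); case: (all _ l).
Qed.

Lemma zigzag_cons2 y a b s : zigzag y [:: a, b & s] =
  [&& shadow_adj y a b, a \in C `\ y & zigzag y (b :: s)].
Proof. by rewrite /zigzag /= andbACA -andbA. Qed.

Lemma zigzag_apex y w s : zigzag y (w :: s) -> C w /\ w <> y.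
Proof. by move=> /andP[_ /andP[/set_mem[Cw wy] _]]. Qed.

Lemma zigzag_nearest_shadow y m s : zigzag y (m :: s) ->
  all (fun w => d y m <= d y w) s -> gromov d m y (last m s) < r + 2 * delta.
Proof.
have [n] := ubnP (size s); elim: n m s => // n IH m [|w' s] ltsn zz near_m.
  by have := delta_gt0; have := r_ge0; rewrite /= gromov_base; lra.
have [l [m' [s' [def_s last_l last_s' near_m']]]] := exists_min_split (d y) w' s.
have [Cm _] := zigzag_apex zz; move: zz; rewrite zigzag_cons2 => /and3P[adj _ zz_s].
have [Cw' _] := zigzag_apex zz_s.
have mw' : d y m <= d y w' by case/andP: near_m.
rewrite def_s in ltsn zz_s near_m near_m'.
move: zz_s near_m near_m'; rewrite zigzag_outwards !all_cat !all_rev.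
move=> /andP[zz_l zz_s'] /and3P[_ mm' _] /and3P[near_l _ near_s'].
rewrite size_cat size_rev addnS ltnS in ltsn.
have [Cm' _] := zigzag_apex zz_s'.
apply: (@shadow_of_nearer y m m' w') => //; [rewrite -last_l|rewrite /= -last_s'];
  by apply: IH => //; apply: leq_ltn_trans ltsn; rewrite ?leq_addr ?leq_addl.
Qed.

Definition linked y a b : Prop := exists2 s, zigzag y (a :: s) & last a s = b.

Lemma linked_refl y a : C a -> a <> y -> linked y a a.
Proof. by move=> Ca ay; exists [::]; rewrite // /zigzag /= andbT; apply/mem_set. Qed.

Lemma linked_cons y a b c : C a -> a <> y -> shadow_adj y a b ->
  linked y b c -> linked y a c.
Proof.
move=> Ca ay ab [s zz last_s]; exists (b :: s) => //.
by rewrite zigzag_cons2 ab zz andbT; apply/mem_set.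
Qed.

Lemma gromov_ge_of_linked y a b : C y -> linked y a b -> r + delta <= gromov d y a b.
Proof.
move=> Cy [s + <-]; have delta0 := delta_gt0.
have [l [m [s' [-> <- <-]]]] := exists_min_split (d y) a s.
rewrite zigzag_outwards all_cat all_rev => /and3P[near_l _ near_s'] /andP[zz_l zz_s'].
have [Cm my] := zigzag_apex zz_l.
have far w : gromov d m y w < r + 2 * delta -> r + delta + delta <= gromov d y m w.
  by move=> /ltW myw; have := gromov_ge_of_opposite Cm Cy my myw; lra.
by apply: (gromov_ge_of_close (w := m)); apply/far/zigzag_nearest_shadow.
Qed.

(* Projecting a whole component at once makes the projections constant along
   shadows, which is (P2+). *)
Definition upgraded_proj p a : set X := \bigcup_(w in linked p a) pi p w.
Local Notation pi' := upgraded_proj.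

Lemma sproj_sub_upgraded_proj p a : C a -> a <> p -> pi p a `<=` pi' p a.
Proof. by move=> Ca ap x pax; exists a => //; apply: linked_refl. Qed.

Lemma upgraded_proj_shadow_adj p u v : C u -> C v -> u <> p -> v <> p ->
  shadow_adj p u v -> pi' p u = pi' p v.
Proof.
move=> Cu Cv up vp uv; have vu : shadow_adj p v u by rewrite /shadow_adj orbC.
congr (\bigcup_(w in _) _); apply/seteqP.
by split=> w; [apply: linked_cons vu|apply: linked_cons uv].
Qed.

Lemma linked_apex y a b : linked y a b -> C b /\ b <> y.
Proof.
move=> [s /andP[_ mem_s] <-]; move: mem_s.
by rewrite lastI all_rcons => /andP[/set_mem].
Qed.

Lemma upgraded_proj_sub_sphere p a : C p -> pi' p a `<=` sphere d r p.
Proof.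
move=> Cp _ [w /linked_apex[Cw wp] [g [geod_g <-]]] /=.
have := sep_C Cw Cp wp; have delta0 := delta_gt0; have r0 := r_ge0.
by rewrite /sphere /= dist_sym => sep; rewrite dist_sym (geodesic_distl geod_g); lra.
Qed.

Lemma upgraded_proj_near_sproj p a x : C p -> pi' p a x ->
  exists2 x', pi p a x' & (dS d r p x x' <= (3 * delta)%:E)%E.
Proof.
move=> Cp [w lw pwx]; have [h geod_h] := geod_d p a.
have pah : pi p a (h r) by exists h.
exists (h r) => //; apply: dS_sproj_le pwx pah => //.
by rewrite gromov_sym; apply: gromov_ge_of_linked lw.
Qed.

Lemma dproj_sproj_le_upgraded p a b : C a -> C b -> a <> p -> b <> p ->
  (dproj d r pi p a b <= dproj d r pi' p a b)%E.
Proof.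
by move=> Ca Cb ap bp; apply: diamS_subset; apply: setUSS; apply: sproj_sub_upgraded_proj.
Qed.

Lemma dproj_upgraded_le p a b : C p ->
  (dproj d r pi' p a b <= dproj d r pi p a b + (2 * (3 * delta))%:E)%E.
Proof.
move=> Cp; have near x : (pi' p a `|` pi' p b) x ->
    exists2 x', (pi p a `|` pi p b) x' & (dS d r p x x' <= (3 * delta)%:E)%E.
  by case=> /(upgraded_proj_near_sproj Cp)[x' px' xx']; exists x' => //; [left|right].
apply: diamS_le => x y /near[x' px' xx'] /near[y' py' yy'].
rewrite (_ : 2 * (3 * delta) = 3 * delta + 3 * delta); last by ring.
rewrite EFinD addeA; apply: le_trans (dS_triangle _ _ y' _ _) _.
apply: leeD; last by rewrite dS_sym.
rewrite addeC; apply: le_trans (dS_triangle _ _ x' _ _) _.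
by apply: leeD => //; apply: dS_le_diam.
Qed.

Lemma dproj_sproj_gt_of_upgraded t p a b : C p -> 9 * delta <= t ->
  (t%:E < dproj d r pi' p a b)%E -> ((3 * delta)%:E < dproj d r pi p a b)%E.
Proof.
rewrite !ltNge => Cp t9; apply: contraNN => small.
apply: le_trans (dproj_upgraded_le a b Cp) _; apply: le_trans (leeD2r _ small) _.
by rewrite -EFinD lee_fin; lra.
Qed.

Lemma upgraded_strong_projection_axioms t : 9 * delta <= t ->
  strong_projection_axioms d r C pi' t.
Proof.
move=> t9; split=> [p a Cp Ca ap|].
  rewrite -[pi' p a]setUid leNgt; apply/negP => /(dproj_sproj_gt_of_upgraded Cp t9).
  by apply/negP; rewrite -leNgt /dproj setUid; apply: diamS_sproj_le.
split=> [x y z w Cx Cy Cz Cw xy xz xw yz yw zw|x z Cx Cz].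
  move=> /(dproj_sproj_gt_of_upgraded Cx t9)/gromov_lt_of_dproj xyz.
  rewrite /dproj (@upgraded_proj_shadow_adj y z x)//; [exact: nesym|].
  by rewrite /shadow_adj gromov_sym xyz orbT.
apply: sub_finite_set (finite_large_projections x z) => y [Cy [yx [yz large]]].
by do 3 split=> //; apply: dproj_sproj_gt_of_upgraded large.
Qed.

Lemma upgraded_proj_spinning a b c p : 2 <= r -> C a -> C b -> C c ->
  b <> a -> c <> a -> on_segment b c p -> d p a <= 1 ->
  ((powR 2 ((r - 2) / delta) - 4 * delta)%:E <= dproj d r pi' a b c)%E.
Proof.
move=> r2 Ca Cb Cc ba ca seg_p pa; have delta0 := delta_gt0.
have ab := sep_C Cb Ca ba; have ac := sep_C Cc Ca ca.
rewrite dist_sym in ab; rewrite dist_sym in ac.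
apply: le_trans (dproj_sproj_le_upgraded Cb Cc ba ca).
have [g geod_g] := geod_d a b; have [h geod_h] := geod_d a c.
have pig : pi a b (g r) by exists g.
have pih : pi a c (h r) by exists h.
apply: le_trans (dS_sproj_ge_exp r2 seg_p pa _ _ pig pih) _; [lra|lra|].
by apply: dS_le_diam; [left|right].
Qed.

(** * Equivariance and spinning *)

Definition isometry_pair (f f' : X -> X) : Prop :=
  [/\ cancel f f', cancel f' f & forall x y, d (f x) (f y) = d x y].

Lemma isometry_pair_inv f f' : isometry_pair f f' -> isometry_pair f' f.
Proof. by move=> [fK f'K f_iso]; split=> // x y; rewrite -[LHS]f_iso !f'K. Qed.

Lemma dS_isometry f f' p x y : isometry_pair f f' ->
  dS d r (f p) (f x) (f y) = dS d r p x y.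
Proof.
have dS_le (F : X -> X) q u v : (forall x y, d (F x) (F y) = d x y) ->
    (dS d r (F q) (F u) (F v) <= dS d r q u v)%E.
  move=> F_iso; apply/ereal_infP => _ [g [cont_g [g0 [g1 out_g]]] <-].
  have -> : path_length d g = path_length d (F \o g).
    congr ereal_sup; apply: eq_imagel => s _; congr EFin.
    by apply: eq_bigr => i _; rewrite /= F_iso.
  apply: dS_le_length; rewrite /outside_path /= g0 g1; split.
    move=> s s01 e e0; have [t t0 near_s] := cont_g s s01 e e0.
    by exists t => // t' t'01 st'; rewrite /= F_iso; apply: near_s.
  by do 2 split=> //; move=> t t01; rewrite F_iso; apply: out_g.
move=> iso_f; have [fK _ f_iso] := iso_f; have [_ _ f'_iso] := isometry_pair_inv iso_f.
apply/eqP; rewrite eq_le dS_le//=.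
by have := dS_le f' (f p) (f x) (f y) f'_iso; rewrite !fK.
Qed.

Lemma diamS_isometry f f' p (A : set X) : isometry_pair f f' ->
  diamS d r (f p) (f @` A) = diamS d r p A.
Proof.
move=> iso_f; apply/eqP; rewrite eq_le; apply/andP; split; apply: diamS_le.
  by move=> _ _ [x Ax <-] [y Ay <-]; rewrite (dS_isometry _ _ _ iso_f) dS_le_diam.
by move=> x y Ax Ay; rewrite -(dS_isometry _ _ _ iso_f) dS_le_diam//; apply: imageP.
Qed.

Definition apex_isometry (f f' : X -> X) : Prop :=
  isometry_pair f f' /\ forall x, C (f x) <-> C x.

Lemma apex_isometry_inv f f' : apex_isometry f f' -> apex_isometry f' f.
Proof.
move=> [iso_f fC]; split=> [|x]; first exact: isometry_pair_inv.
by have [_ f'K _] := iso_f; rewrite -fC f'K.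
Qed.

Lemma linked_isometry f f' y a b : apex_isometry f f' ->
  linked y a b -> linked (f y) (f a) (f b).
Proof.
move=> [[fK _ f_iso] fC] [s /andP[path_s mem_s] <-].
exists (map f s); last exact: last_map.
apply/andP; split; rewrite -map_cons.
  rewrite /= path_map; apply: sub_path path_s => u v /=.
  by rewrite /shadow_adj /gromov !f_iso.
rewrite all_map; apply: sub_all mem_s => w /set_mem[Cw wy].
by apply/mem_set; split; [exact/fC|move/(can_inj fK)].
Qed.

Lemma sproj_isometry f f' p a x : isometry_pair f f' -> pi p a x -> pi (f p) (f a) (f x).
Proof.
move=> [_ _ f_iso] [g [[g0 [g1 g_iso]] <-]]; exists (f \o g); split=> //.
by rewrite /geodesic f_iso /= g0 g1; do 2 split=> //; move=> s t ? ?; rewrite f_iso g_iso.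
Qed.

Lemma upgraded_proj_isometry f f' p a : apex_isometry f f' ->
  pi' (f p) (f a) = f @` pi' p a.
Proof.
have push F F' q b x : apex_isometry F F' -> pi' q b x -> pi' (F q) (F b) (F x).
  move=> iso_F [w lw pwx]; exists (F w); first exact: (linked_isometry iso_F lw).
  exact: (sproj_isometry iso_F.1 pwx).
move=> iso_f; have [[fK f'K _] _] := iso_f.
apply/seteqP; split=> [x|_ [x px <-]]; last exact: (push _ _ _ _ _ iso_f px).
move=> /(push _ _ _ _ _ (apex_isometry_inv iso_f)); rewrite !fK => px.
by exists (f' x).
Qed.

Lemma dproj_upgraded_isometry f f' p a b : apex_isometry f f' ->
  dproj d r pi' (f p) (f a) (f b) = dproj d r pi' p a b.
Proof.
move=> iso_f; rewrite /dproj !(upgraded_proj_isometry _ _ iso_f) -image_setU.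
exact: diamS_isometry iso_f.1.
Qed.

Lemma pc_adj_isometry f f' K p q : apex_isometry f f' ->
  pc_adj d r C pi' K p q -> pc_adj d r C pi' K (f p) (f q).
Proof.
move=> iso_f [Cp [Cq [pq adj]]]; have [[fK f'K _] fC] := iso_f.
split; [exact/fC|split; [exact/fC|split=> [/(can_inj fK)//|]]].
move=> y; rewrite -(f'K y) => /fC Cy yp yq; rewrite (dproj_upgraded_isometry _ _ _ iso_f).
by apply: adj => // [yp'|yq']; [apply: yp; rewrite yp'|apply: yq; rewrite yq'].
Qed.

Lemma pc_within_isometry f f' K n p q : apex_isometry f f' ->
  pc_within d r C pi' K n p q <-> pc_within d r C pi' K n (f p) (f q).
Proof.
have push F F' u v : apex_isometry F F' ->
    pc_within d r C pi' K n u v -> pc_within d r C pi' K n (F u) (F v).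
  move=> iso_F; have [_ FC] := iso_F.
  elim: n u => [|m IH] u /=; first by move=> [/FC Cu <-].
  move=> [[/FC Cu <-]|[y [uy yv]]]; first by left.
  by right; exists (F y); split; [apply: (pc_adj_isometry iso_F uy)|apply: IH].
move=> iso_f; split; first exact: (push _ _ _ _ iso_f).
move=> /(push _ _ _ _ (apex_isometry_inv iso_f)); have [[fK _ _] _] := iso_f.
by rewrite !fK.
Qed.

Section GroupAction.
Variables (G : Type) (mul : G -> G -> G) (one : G) (inv : G -> G) (act : G -> X -> X).
Variable Gc : X -> set G.
Hypothesis group_G : is_group mul one inv.
Hypothesis act_isometric : isometric_action mul one d act.
Hypothesis rot_Gc : rotating_family mul one inv act C Gc.

Lemma act_isometry_pair (g : G) : isometry_pair (act g) (act (inv g)).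
Proof.
have [mulA [mul1 mulV]] := group_G; have [act1 [actM act_iso]] := act_isometric.
have mulgV (g' : G) : mul g' (inv g') = one.
  have invK : mul (inv (inv g')) one = g' by rewrite -(mulV g') mulA mulV mul1.
  by rewrite -{1}invK -mulA mul1 mulV.
split=> [x|x|]; [by rewrite -actM mulV act1|by rewrite -actM mulgV act1|exact: act_iso].
Qed.

Lemma act_apex_isometry (g : G) : apex_isometry (act g) (act (inv g)).
Proof.
have [actC _] := rot_Gc; have [actK _ _] := act_isometry_pair g.
split=> [|x]; first exact: act_isometry_pair.
by split=> [/(actC (inv g))|]; [rewrite actK|apply: actC].
Qed.

Lemma fairly_rotating_spinning a b (g : G) : 2 <= r -> fairly_rotating one d act C Gc ->
  C a -> C b -> a <> b -> Gc a g -> g <> one ->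
  ((powR 2 ((r - 2) / delta) - 4 * delta)%:E <= dproj d r pi' a b (act g b))%E.
Proof.
move=> r2 fair Ca Cb ab ga g1; have [actC [_ [fixGc _]]] := rot_Gc.
have [actK _ _] := act_isometry_pair g.
have [k [geod_k [t t_itv ka]]] := fair a g b Ca ga g1 Cb (nesym ab).
apply: (upgraded_proj_spinning (p := k t)) => //.
- exact: actC.
- exact: nesym.
- by rewrite -[X in _ <> X](fixGc a g Ca ga) => /(can_inj actK)/esym.
- by exists k, t.
Qed.

End GroupAction.
End Apices.
End Hyperbolic.
End MetricSpace.

Theorem theorem3p2 (R : realType) (X : Type) (d : X -> X -> R)
  (G : Type) (mul : G -> G -> G) (one : G) (inv : G -> G) (act : G -> X -> X)
  (C : set X) (Gc : X -> set G) (delta rho r theta : R) :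
  is_metric d -> geodesic_space d -> 0 < delta -> hyperbolic d delta ->
  is_group mul one inv -> isometric_action mul one d act ->
  rotating_family mul one inv act C Gc -> rho_separated d rho C ->
  fairly_rotating one d act C Gc -> 20 * delta <= rho ->
  2 + 2 * delta <= r -> r <= rho / 2 - 3 * delta ->
  121 * delta <= theta ->
  exists (pi' : X -> X -> set X),
    (* pi' is an upgrade of the projection data (Y, pi) *)
    (exists theta0 : R,
       projection_axioms d r C (sproj d r) theta0 /\ 11 * theta0 <= theta /\
       (forall p a, C p -> C a -> a <> p -> pi' p a `<=` sphere d r p) /\
       (forall p a b, C p -> C a -> C b -> a <> p -> b <> p ->
          (dproj d r (sproj d r) p a b - (2 * theta0)%:E <= dproj d r pi' p a b)%E /\
          (dproj d r pi' p a b <= dproj d r (sproj d r) p a b + (2 * theta0)%:E)%E)) /\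
    strong_projection_axioms d r C pi' theta /\
    (* G acts by isometries on the projection complex P(Y, theta, K) *)
    (forall K, 3 * theta <= K -> forall g n p q, C p -> C q ->
       pc_within d r C pi' K n p q <-> pc_within d r C pi' K n (act g p) (act g q)) /\
    (* {G_c} is an L-spinning family, L = 2^((r-2)/delta) - 4 - 248 delta *)
    (forall a b g, C a -> C b -> a <> b -> Gc a g -> g <> one ->
       ((powR 2 ((r - 2) / delta) - 4 - 248 * delta)%:E
          <= dproj d r pi' a b (act g b))%E).
Proof.
move=> metric_d geod_d delta_gt0 hyp_d group_G act_isometric rot_Gc sep fair.
move=> rho_ge r_ge r_le theta_ge; have [r_ge0 r_ge2] : 0 <= r /\ 2 <= r by lra.
have sep_C : rho_separated d (2 * r + 6 * delta) C.
  by move=> c c' Cc Cc' cc'; apply: le_trans (sep _ _ Cc Cc' cc'); lra.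
exists (upgraded_proj d delta r C); split; [|split; [|split]].
- exists (3 * delta); split; first exact: sproj_projection_axioms.
  split; first by lra.
  split=> [p a Cp _ _|p a b Cp Ca Cb ap bp].
    exact: (upgraded_proj_sub_sphere metric_d delta_gt0).
  split; last exact: (dproj_upgraded_le metric_d geod_d delta_gt0 hyp_d r_ge0 sep_C).
  apply: le_trans (dproj_sproj_le_upgraded d delta r Ca Cb ap bp).
  by rewrite leeBlDr// leeDl// lee_fin; lra.
- apply: (upgraded_strong_projection_axioms metric_d geod_d delta_gt0 hyp_d r_ge0 sep_C).
  by lra.
- move=> K _ g n p q _ _; apply: pc_within_isometry.
  exact: (act_apex_isometry group_G act_isometric rot_Gc).
- move=> a b g Ca Cb ab ga g1.
  apply: le_trans (fairly_rotating_spinning metric_d geod_d delta_gt0 hyp_d sep_C group_G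
    act_isometric rot_Gc r_ge2 fair Ca Cb ab ga g1).
  by rewrite lee_fin; lra.
Qed.
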